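(* Let $n \ge 1$ and let $\mathrm{Fl} = \{\mathrm{fl}_1,\dots,\mathrm{fl}_n\}$ be a tuple of functions which round to nearest in an IEEE system $\mathcal{I}$ with unit roundoff $u$. If $20 n u \leq 1$ and $y_0,\dots,y_n \in \mathcal{I}$, then $$\left| \mathrm{Fl}\left(\sum_{k=0}^n y_k\right) - \sum_{k=0}^n y_k \right| \leq \frac{n u}{1 + n u} \sum_{k=0}^n |y_k|.$$
   Context: Let $\beta \ge 2$ be an integer (the base) and $\mu \ge 1$ an integer. The unit roundoff is $u := 1/(2\beta^{\mu})$. For $e\in\mathbb{Z}$ let $\mathcal{E}_e := \{\beta^e(\beta^\mu + r) : r = 0,1,\dots,(\beta-1)\beta^\mu - 1\}$. For an integer $e_\alpha < -\mu$ let $\mathcal{S}_{e_\alpha} := \{\beta^{e_\alpha} r : r = 1,\dots,\beta^\mu-1\}$ (positive subnormal numbers). The IEEE system associated to $\beta,\mu,e_\alpha$ is $\mathcal{I} := \{0\}\cup \mathcal{S}_{e_\alpha}\cup -\mathcal{S}_{e_\alpha} \cup \bigcup_{e\ge e_\alpha} (\mathcal{E}_e \cup -\mathcal{E}_e)$. A function $\mathrm{fl}:\mathbb{R}\to\mathbb{R}$ rounds to nearest in a system $\mathcal{F}$ if for all $z\in\mathbb{R}$ one has $\mathrm{fl}(z)\in\mathcal{F}$ and $|\mathrm{fl}(z)-z|\le|x-z|$ for all $x\in\mathcal{F}$ (ties may be broken arbitrarily). A tuple $\mathrm{Fl}=\{\mathrm{fl}_1,\dots,\mathrm{fl}_n\}$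 rounds to nearest in $\mathcal{F}$ if each $\mathrm{fl}_k$ does (the $\mathrm{fl}_k$ may differ). Floating point sum: for real $y_0,\dots,y_n$, put $\hat s_1 := \mathrm{fl}_1(y_0+y_1)$ and $\hat s_k := \mathrm{fl}_k(\hat s_{k-1}+y_k)$ for $2\le k\le n$. Then $\mathrm{Fl}\left(\sum_{k=0}^n y_k\right) := \hat s_n$. *)

(* Defs.v *)
From HB Require Import structures.
From mathcomp Require Import all_boot all_order all_algebra.
From mathcomp Require Import classical_sets reals.

Set Implicit Arguments.
Unset Strict Implicit.
Unset Printing Implicit Defensive.

Import Order.TTheory GRing.Theory Num.Theory.

Local Open Scope classical_set_scope.
Local Open Scope ring_scope.

Definition unit_roundoff (R : realType) (beta mu : nat) : R :=
  1 / (2 * beta%:R ^+ mu).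

Definition binade (R : realType) (beta mu : nat) (e : int) : set R :=
  [set x | exists r : nat,
     (r < (beta - 1) * beta ^ mu)%N /\
     x = beta%:R ^ e * (beta%:R ^+ mu + r%:R)].

Definition subnormals (R : realType) (beta mu : nat) (ea : int) : set R :=
  [set x | exists r : nat, (1 <= r < beta ^ mu)%N /\ x = beta%:R ^ ea * r%:R].

(* The standing assumptions 2 <= beta, 1 <= mu and ea < - mu are not built into
   the definition; they are hypotheses wherever the system is used. *)
Definition ieee_system (R : realType) (beta mu : nat) (ea : int) : set R :=
  [set 0]
  `|` subnormals beta mu ea
  `|` -%R @` subnormals beta mu ea
  `|` \bigcup_(e in [set e : int | ea <= e])
        (binade beta mu e `|` -%R @` binade beta mu e).

Definition rounds_to_nearest (R : realType) (F : set R) (fl : R -> R) : Prop :=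
  forall z : R, F (fl z) /\ forall x : R, F x -> `|fl z - z| <= `|x - z|.

(* The floating point sum of y 0, ..., y n is [fl_sum fl y n] for 1 <= n. The
   rounding functions are fl 1, ..., fl n; fl 0 is not used. The value y 0 at
   n = 0 makes the first step fl 1 (y 0 + y 1), so y 0 itself is not rounded. *)
Fixpoint fl_sum (R : realType) (fl : nat -> R -> R) (y : nat -> R) (n : nat) : R :=
  match n with
  | 0%N => y 0%N
  | k.+1 => fl k.+1 (fl_sum fl y k + y k.+1)
  end.

(* Main.v *)
Require Import Defs.
From HB Require Import structures.
From mathcomp Require Import all_boot all_order all_algebra.
From mathcomp Require Import classical_sets reals.
From mathcomp Require Import zify ring lra.

Set Implicit Arguments.
Unset Strict Implicit.
Unset Printing Implicit Defensive.

Import Order.TTheory GRing.Theory Num.Theory.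

Local Open Scope classical_set_scope.
Local Open Scope ring_scope.

(** The error of the sum is the sum of the local errors [d i] committed when
    [z i = s i + y i.+1] is rounded, [s i] being the i-th computed partial sum.
    Let [w] be the largest power of the base, among the leading powers of the
    [z i], and let [k] be the first index with [w <= |z k|].  Everything rests
    on four bounds for the local errors:
    - every error is at most [u * w], since all the [z i] are below the next
      power of the base ([nearest_error_le]);
    - an error before [k] is at most half of that, since [z i] then lies in a
      lower binade, where the spacing is at most half as large, or is a
      multiple of the smallest positive number and is not rounded at all
      ([nearest_error_half]);
    - the error at [k] is at most [|z k| - w], since [w] is itself a floating
      point number;
    - an error after [k] is at most [|y i.+1|], since [s i] is a floating
      point number.
    Write [A], [D], [B] for the sums of the absolute errors before, at and
    after [k].  The last two bounds turn errors into lower bounds on the data: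
    [|z k|] exceeds the sum of the [|y j|] with [j <= k.+1] by at most [A], so
    the sum of all [|y j|] is at least [w + D - A + B].  The claim
    [(1 + n u) (A + D + B) <= n u (w + D - A + B)] is equivalent to
    [(1 + 2 n u) A + D + B <= n u w].  As [2 n u <= 1], this follows from
    [2 A <= k u w] and [D + B <= (n - k) u w] ([error_sum_le]).

    If no [z i] reaches the normal range, then nothing is ever rounded. *)

(** * Grid points of an IEEE system *)

Section IeeeSystem.
Variables (R : realType) (beta mu : nat) (ea : int).
Hypothesis hbeta : (2 <= beta)%N.

Local Notation b := (beta%:R : R).
Local Notation I := (@ieee_system R beta mu ea).
Local Notation u := (unit_roundoff R beta mu).

Lemma base_gt0 : 0 < b.
Proof. by rewrite ltr0n; lia. Qed.

Lemma base_neq0 : b != 0.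
Proof. by rewrite gt_eqF ?base_gt0. Qed.

Lemma base_expS (e : int) : b ^ (e + 1) = b ^ e * b.
Proof. by rewrite exprzDr ?unitfE ?base_neq0. Qed.

Lemma ieee_opp x : I x -> I (- x).
Proof.
case=> [[[->|Sx]|[x' Sx <-]]|[e he [Ex|[x' Ex <-]]]].
- by rewrite oppr0; left; left; left.
- by left; right; exists x.
- by rewrite opprK; left; left; right.
- by right; exists e => //; right; exists x.
- by rewrite opprK; right; exists e => //; left.
Qed.

Lemma ieee_normal (e : int) (r : nat) : ea <= e ->
  (beta ^ mu <= r < beta ^ mu.+1)%N -> I (b ^ e * r%:R).
Proof.
move=> he /andP[r1 r2]; right; exists e => //; left.
exists (r - beta ^ mu)%N; split; last by rewrite -natrX -natrD subnKC.
by rewrite mulnBl mul1n -expnS ltn_sub2r // (leq_ltn_trans r1).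
Qed.

(** A multiple of [b ^ e] with fewer than [mu.+1] digits is a multiple of
    [b ^ (e - 1)] with at most [mu.+1] digits, so one can descend to the
    subnormal numbers.  The value [r = beta ^ mu.+1] is allowed since it
    gives the first number of the following binade. *)
Lemma ieee_nat_multiple (e : int) (r : nat) : ea <= e ->
  (r <= beta ^ mu.+1)%N -> I (b ^ e * r%:R).
Proof.
move=> he; have -> : e = ea + `|e - ea|%N%:Z by lia.
elim: `|e - ea|%N r => {e he} [|a IHa] r rle.
all: have Bpos : (0 < beta ^ mu)%N by rewrite expn_gt0; lia.
all: have [rlt|rge] := ltnP r (beta ^ mu).
2,4: move: rle; rewrite leq_eqVlt => /orP[/eqP->|rlt];
       last by apply: ieee_normal; [lia|rewrite rge].
2,3: rewrite expnS natrM mulrA -base_expS;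
       apply: ieee_normal; [lia|rewrite leqnn ltn_exp2l//=].
- rewrite addr0; case: r => [|r] in rle rlt *.
    by rewrite mulr0; left; left; left.
  by left; left; right; exists r.+1.
- have -> : b ^ (ea + a.+1%:Z) * r%:R = b ^ (ea + a%:Z) * (beta * r)%N%:R.
    by rewrite natrM mulrA -base_expS; congr (b ^ _ * _); lia.
  by apply: IHa; rewrite expnS leq_mul2l ltnW ?orbT.
Qed.

Lemma ieee_multiple (e m : int) : ea <= e ->
  (`|m| <= beta ^ mu.+1)%N -> I (b ^ e * m%:~R).
Proof.
move=> he; case: (intP m) => [|r|r] mle.
- exact: (@ieee_nat_multiple e 0).
- exact: ieee_nat_multiple.
- by rewrite mulrNz mulrN; apply: ieee_opp; apply: ieee_nat_multiple => //; lia.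
Qed.

Lemma ieee_on_grid x : I x -> exists m : int, x = b ^ ea * m%:~R.
Proof.
have grid_opp t : (exists m : int, t = b ^ ea * m%:~R) ->
    exists m : int, - t = b ^ ea * m%:~R.
  by move=> [m ->]; exists (- m); rewrite mulrNz mulrN.
have sub t : subnormals beta mu ea t -> exists m : int, t = b ^ ea * m%:~R.
  by move=> [r [_ ->]]; exists r%:Z.
have bin (e : int) t : ea <= e -> binade beta mu e t ->
    exists m : int, t = b ^ ea * m%:~R.
  move=> he [r [_ ->]]; pose a := `|e - ea|%N.
  exists (beta ^ a * (beta ^ mu + r))%N%:Z; have -> : e = ea + a%:Z by lia.
  rewrite exprzDr ?unitfE ?base_neq0 // -mulrA; congr (_ * _).
  by rewrite -pmulrn natrM natrD !natrX.
case=> [[[->|Sx]|[x' Sx <-]]|[e he [Ex|[x' Ex <-]]]].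
- by exists 0; rewrite mulr0.
- exact: sub.
- by apply: grid_opp; apply: sub.
- exact: bin Ex.
- by apply: grid_opp; apply: bin Ex.
Qed.

(** * Errors of rounding to nearest *)

Variable fl : R -> R.
Hypothesis hfl : rounds_to_nearest I fl.

Lemma roundoff_lead (e : int) : u * (b ^ e * b ^+ mu) = b ^ e / 2.
Proof.
have bmu : b ^+ mu != 0 by rewrite expf_neq0 ?base_neq0.
by rewrite /unit_roundoff; field.
Qed.

(** Up to the end of the binade of [e], all multiples of [b ^ e] are in the
    system, and [u * (b ^ e * b ^+ mu)] is half of that spacing. *)
Lemma nearest_error_le (e : int) (z : R) : ea <= e ->
  `|z| <= b ^ e * b ^+ mu.+1 -> `|fl z - z| <= u * (b ^ e * b ^+ mu).
Proof.
move=> he zle; rewrite roundoff_lead.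
have q0 : 0 < b ^ e by rewrite exprz_gt0 ?base_gt0.
pose x := z / b ^ e; have zE : z = b ^ e * x by rewrite mulrC divfK ?gt_eqF.
pose m := Num.floor (x + 1 / 2).
have m1 : m%:~R <= x + 1 / 2 by apply: floor_le.
have m2 : x + 1 / 2 < m%:~R + 1 by have := floorD1_gt (x + 1/2); rewrite intrD.
have : `|x| <= (beta ^ mu.+1)%N%:R.
  by rewrite natrX -(ler_pM2l q0) -{1}(gtr0_norm q0) -normrM -zE.
rewrite ler_norml => /andP[x1 x2].
have mle : m < (beta ^ mu.+1)%N%:Z + 1.
  by rewrite -(ltr_int R) intrD -pmulrn; lra.
have mge : - (beta ^ mu.+1)%N%:Z - 1 < m.
  by rewrite -(ltr_int R) intrD mulrNz -pmulrn; lra.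
have Im : I (b ^ e * m%:~R) by apply: ieee_multiple => //; lia.
apply: le_trans ((hfl z).2 _ Im) _.
rewrite {1}zE -mulrBr normrM gtr0_norm // ler_pM2l // ler_norml.
by apply/andP; split; lra.
Qed.

(** If [ea < e], then [x + y] is within reach of the next lower binade, whose
    spacing is smaller by a factor [b >= 2].  If [e = ea], there is no such
    binade, but [x + y] inherits from its terms that it is a multiple of the
    smallest positive number, hence it is in the system and not rounded. *)
Lemma nearest_error_half (e : int) (x y : R) : ea <= e -> I x -> I y ->
  `|x + y| <= b ^ e * b ^+ mu ->
  `|fl (x + y) - (x + y)| <= u * (b ^ e * b ^+ mu) / 2.
Proof.
move=> he Ix Iy zle; have q0 : 0 < b ^ e by rewrite exprz_gt0 ?base_gt0.
have [ee|ene] := eqVneq e ea.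
  have [m mE] := ieee_on_grid Ix; have [m' mE'] := ieee_on_grid Iy.
  have zE : x + y = b ^ ea * (m + m')%:~R by rewrite mE mE' intrD mulrDr.
  have : `|(m + m')%:~R| <= (beta ^ mu)%N%:R :> R.
    by rewrite natrX -(ler_pM2l q0) -{1}(gtr0_norm q0) -normrM {1}ee -zE.
  rewrite -intr_norm pmulrn ler_int => mle.
  have Iz : I (x + y).
    rewrite zE; apply: ieee_multiple => //.
    have : (beta ^ mu <= beta ^ mu.+1)%N by rewrite leq_exp2l.
    by lia.
  apply: le_trans ((hfl (x + y)).2 _ Iz) _.
  by rewrite subrr normr0 roundoff_lead; lra.
have eE : e = (e - 1) + 1 by lia.
have he' : ea <= e - 1 by lia.
have wE : b ^ e = b ^ (e - 1) * b by rewrite {1}eE base_expS.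
apply: le_trans (nearest_error_le he' _) _.
  by rewrite exprS mulrA -wE.
rewrite !roundoff_lead wE.
have q1 : 0 < b ^ (e - 1) by rewrite exprz_gt0 ?base_gt0.
have b2 : 2 <= b by rewrite (ler_nat R 2).
have : b ^ (e - 1) * 2 <= b ^ (e - 1) * b by rewrite ler_pM2l.
by lra.
Qed.

Lemma nearest_error_lead (e : int) (z : R) : ea <= e ->
  b ^ e * b ^+ mu <= `|z| -> `|fl z - z| <= `|z| - b ^ e * b ^+ mu.
Proof.
move=> he zge.
have Iw : I (b ^ e * b ^+ mu).
  by rewrite -natrX; apply: ieee_nat_multiple => //; rewrite leq_exp2l.
have w0 : 0 <= b ^ e * b ^+ mu.
  by rewrite mulr_ge0 ?exprz_ge0 ?exprn_ge0 ?ltW ?base_gt0.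
have [z0|z0] := leP 0 z.
  apply: le_trans ((hfl z).2 _ Iw) _; move: zge.
  by rewrite ger0_norm // => zge; rewrite ler0_norm; lra.
apply: le_trans ((hfl z).2 _ (ieee_opp Iw)) _; move: zge.
by rewrite ltr0_norm // => zge; rewrite ger0_norm; lra.
Qed.

Lemma nearest_error_term (x y : R) : I x -> `|fl (x + y) - (x + y)| <= `|y|.
Proof.
move=> Ix; apply: le_trans ((hfl (x + y)).2 _ Ix) _.
by rewrite opprD addNKr normrN.
Qed.

End IeeeSystem.

(** * Accumulation of the errors *)

Lemma fl_sumE (R : realType) (fl : nat -> R -> R) (y : nat -> R) (n : nat) :
  fl_sum fl y n = \sum_(0 <= j < n.+1) y j +
    \sum_(0 <= i < n) (fl_sum fl y i.+1 - (fl_sum fl y i + y i.+1)).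
Proof.
elim: n => [|n IHn]; first by rewrite big_nat1 big_geq // addr0.
rewrite [X in _ = X + _]big_nat_recr // [X in _ = _ + X]big_nat_recr //=.
by set t := fl n.+1 _; rewrite {}IHn; ring.
Qed.

Lemma sum_norm_le_const (R : numDomainType) (d : nat -> R) (c : R) (i j : nat) :
  (forall l, (i <= l < j)%N -> `|d l| <= c) ->
  \sum_(i <= l < j) `|d l| <= (j - i)%:R * c.
Proof.
move=> dle; rewrite mulr_natl -sumr_const_nat.
by apply: ler_sum_nat => l /dle.
Qed.

(** The bounds [|d k| <= |z| - w] and [|d i| <= |y i.+1|] serve to bound the
    sum of the [|y j|] from below in terms of the errors, the other ones to
    bound the errors from above. *)
Lemma error_sum_le (R : realFieldType) (n k : nat) (u w z : R) (d y : nat -> R) :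
  0 <= u -> 0 <= w -> 2 * (n%:R * u) <= 1 -> (k < n)%N ->
  z = \sum_(0 <= j < k.+2) y j + \sum_(0 <= i < k) d i ->
  (forall i, (i < k)%N -> `|d i| <= u * w / 2) ->
  `|d k| <= `|z| - w ->
  (forall i, (k <= i < n)%N -> `|d i| <= u * w) ->
  (forall i, (k < i < n)%N -> `|d i| <= `|y i.+1|) ->
  `|\sum_(0 <= i < n) d i|
    <= n%:R * u / (1 + n%:R * u) * \sum_(0 <= j < n.+1) `|y j|.
Proof.
move=> u0 w0 nu kn zE dbefore dk dle dafter.
pose A := \sum_(0 <= i < k) `|d i|; pose B := \sum_(k.+1 <= i < n) `|d i|.
pose S := \sum_(0 <= j < n.+1) `|y j|.
have A0 : 0 <= A by apply: sumr_ge0.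
have Ale : A <= k%:R * (u * w / 2).
  by have := @sum_norm_le_const _ d (u * w / 2) 0 k dbefore; rewrite subn0.
have DBle : `|d k| + B <= (n%:R - k%:R) * (u * w).
  rewrite -natrB; last exact: ltnW.
  by rewrite /B -big_ltn //; apply: sum_norm_le_const.
have Ele : `|\sum_(0 <= i < n) d i| <= A + (`|d k| + B).
  apply: le_trans (ler_norm_sum _ _ _) _.
  by rewrite (big_cat_nat (n := k)) ?(ltnW kn) //= (big_ltn kn).
have Sge : w + `|d k| - A + B <= S.
  have zle : `|z| <= \sum_(0 <= j < k.+2) `|y j| + A.
    rewrite zE; apply: le_trans (ler_normD _ _) _.
    by apply: lerD; apply: ler_norm_sum.
  have Ble : B <= \sum_(k.+2 <= j < n.+1) `|y j|.
    by rewrite big_add1 /=; apply: ler_sum_nat => i /dafter.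
  by rewrite /S (big_cat_nat (n := k.+2)) //=; lra.
set E := `|\sum_(0 <= i < n) d i| in Ele *.
have c0 : 0 <= n%:R * u by rewrite mulr_ge0 ?ler0n.
set c := n%:R * u in nu c0 *.
have cw : c * w = n%:R * (u * w) by rewrite /c mulrA.
have cA : 2 * (c * A) <= A by nra.
rewrite mulrAC ler_pdivlMr -/S; last by lra.
have h1 : E * (1 + c) <= (A + (`|d k| + B)) * (1 + c).
  by apply: ler_wpM2r => //; lra.
have h2 : c * (w + `|d k| - A + B) <= c * S by apply: ler_wpM2l.
by apply: le_trans h1 (le_trans _ h2); lra.
Qed.

Theorem corollary3 (R : realType) (beta mu : nat) (ea : int)
    (hbeta : (2 <= beta)%N) (hmu : (1 <= mu)%N) (hea : ea < - mu%:Z)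
    (n : nat) (hn : (1 <= n)%N) (fl : nat -> R -> R) (y : nat -> R)
    (hfl : forall k : nat, (1 <= k <= n)%N ->
       rounds_to_nearest (ieee_system beta mu ea) (fl k))
    (hu : 20 * n%:R * unit_roundoff R beta mu <= 1)
    (hy : forall k : nat, (k <= n)%N -> ieee_system beta mu ea (y k)) :
  `|fl_sum fl y n - \sum_(0 <= k < n.+1) y k|
    <= n%:R * unit_roundoff R beta mu / (1 + n%:R * unit_roundoff R beta mu)
       * \sum_(0 <= k < n.+1) `|y k|.
Proof.
pose b : R := beta%:R; pose s := fl_sum fl y; pose z i := s i + y i.+1.
pose d i := s i.+1 - z i; set u := unit_roundoff R beta mu in hu *.
have b0 : 0 < b by apply: base_gt0.
have u0 : 0 <= u by rewrite /u /unit_roundoff divr_ge0 ?mulr_ge0 ?exprn_ge0 ?ltW.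
have nu0 : 0 <= n%:R * u by rewrite mulr_ge0.
have -> : fl_sum fl y n - \sum_(0 <= k < n.+1) y k = \sum_(0 <= i < n) d i.
  by rewrite fl_sumE addrC addKr.
have hfli i : (i < n)%N -> rounds_to_nearest (ieee_system beta mu ea) (fl i.+1).
  by move=> lin; apply: hfl.
have hs i : (i <= n)%N -> ieee_system beta mu ea (s i).
  by case: i => [|i] lin; [apply: hy | apply: (hfli _ lin _).1].
pose lead (m : nat) : R := b ^ (ea + m%:Z) * b ^+ mu.
have leadS m : lead m.+1 = b ^ (ea + m%:Z) * b ^+ mu.+1.
  rewrite /lead exprS mulrA -base_expS //; congr (b ^ _ * _).
  by lia.
have ea_le m : ea <= ea + m%:Z by lia.
pose P m := [forall i : 'I_n, `|z i| < lead m].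
have exP : exists m, P m.
  have lead0 : 0 < lead 0%N by rewrite mulr_gt0 ?exprz_gt0 ?exprn_gt0.
  pose x : R := (\sum_(i < n) `|z i|) / lead 0%N.
  have x0 : 0 <= x by rewrite divr_ge0 ?sumr_ge0 ?ltW.
  exists (Num.bound x); apply/forallP => i.
  have zx : `|z i| <= x * lead 0%N.
    by rewrite divfK ?gt_eqF // (bigD1 i) //= lerDl sumr_ge0.
  apply: le_lt_trans zx _.
  have -> : lead (Num.bound x) = b ^+ Num.bound x * lead 0%N.
    rewrite /lead addr0 exprzDr ?unitfE ?gt_eqF //.
    by rewrite -exprnP; ring.
  rewrite ltr_pM2r //; apply: lt_le_trans (archi_boundP x0) _.
  by rewrite /b -natrX ler_nat ltnW // ltn_expl.
case: (ex_minnP exP) => -[|m] /forallP Pm mmin.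
  (* Every intermediate sum is below the normal range, on the subnormal grid. *)
  rewrite big_nat big1 => [|i /andP[_ lin]].
    by rewrite normr0 mulr_ge0 ?sumr_ge0 // divr_ge0 //; lra.
  have zi : `|z i| < lead 0%N := Pm (Ordinal lin).
  have [p pE] := ieee_on_grid hbeta (hs _ (ltnW lin)).
  have [q qE] := ieee_on_grid hbeta (hy _ lin).
  have zE : z i = b ^ ea * (p + q)%:~R by rewrite /z pE qE intrD mulrDr.
  have q0 : 0 < b ^ ea by rewrite exprz_gt0.
  have : `|(p + q)%:~R| < (beta ^ mu)%N%:R :> R.
    rewrite natrX -(ltr_pM2l q0) -{1}(gtr0_norm q0) -normrM -zE.
    by move: zi; rewrite /lead addr0.
  rewrite -intr_norm pmulrn ltr_int => pq.
  have Iz : ieee_system beta mu ea (z i).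
    rewrite zE; apply: ieee_multiple => //.
    have : (beta ^ mu <= beta ^ mu.+1)%N by rewrite leq_exp2l.
    by lia.
  have := (hfli _ lin (z i)).2 _ Iz.
  by rewrite subrr normr0 normr_le0 => /eqP.
(* By minimality of [m.+1], the power [lead m] is the largest one reached by an
   intermediate sum. *)
have exk : exists k, (k < n)%N && (lead m <= `|z k|).
  have /forallPn[k] : ~~ P m by apply/negP => /mmin; rewrite ltnn.
  by rewrite -leNgt => zk; exists k; rewrite ltn_ord.
case: (ex_minnP exk) => k /andP[kn zk] kmin.
apply: (@error_sum_le _ n k u (lead m) (z k)) => //.
- by rewrite mulr_ge0 ?exprz_ge0 ?exprn_ge0 ?ltW.
- by lra.
- by rewrite /z /s fl_sumE [in RHS]big_nat_recr //= addrAC.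
- move=> i ik; have lin := ltn_trans ik kn.
  have [Is Iy] := (hs _ (ltnW lin), hy _ lin).
  apply: (nearest_error_half hbeta (hfli _ lin) (ea_le m) Is Iy).
  rewrite leNgt; apply/negP => /ltW zi.
  by have := kmin i; rewrite lin zi /= leqNgt ik => /(_ isT).
- exact: (nearest_error_lead hbeta (hfli _ kn) (ea_le m) zk).
- move=> i /andP[_ lin].
  apply: (nearest_error_le hbeta (hfli _ lin) (ea_le m)).
  by have := Pm (Ordinal lin); rewrite leadS => /ltW.
- move=> i /andP[_ lin].
  exact: (nearest_error_term (hfli _ lin) _ (hs _ (ltnW lin))).
Qed.
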